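(* Let $G$ be a hyperbolic group, and let $H\subset G$ be a quasiconvex subgroup with $[G:H]=\infty$. Let $K\subset H$ be a subgroup, and let $K^G$ denote the normal closure of $K$ in $G$. If $K$ is infinite, then $[K^G:K]=\infty$. In particular, any subgroup of $H$ that is normal in $G$ is finite.
   Context: All generating sets are finite and closed under inversion. For a group $G$ with generating set $\Sigma$, the Cayley graph $\Gamma=C(G,\Sigma)$ has vertex set $G$ and edges joining $g,g'$ with $g'=gc$ for some $c\in\Sigma$, with the path metric in which edges have length $1$. $G$ is hyperbolic if $\Gamma$ is a (Gromov-)hyperbolic geodesic space; this does not depend on $\Sigma$. A subgroup $H\subset G$ is quasiconvex if there is $C\ge 0$ such that for all $p,q\in H$ every geodesic from $p$ to $q$ in $\Gamma$ lies in the closed $C$-neighborhood of $H$. *)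

(* Defs.v *)
From HB Require Import structures.
From mathcomp Require Import all_boot all_order all_algebra.
From mathcomp Require Import boolp classical_sets functions cardinality reals.

Set Implicit Arguments.
Unset Strict Implicit.
Unset Printing Implicit Defensive.

Import Order.TTheory GRing.Theory Num.Theory.

Local Open Scope classical_set_scope.
Local Open Scope ring_scope.

(* [groupType] is the type of arbitrary, possibly infinite, groups. *)
Section Groups.
Variable G : groupType.
Implicit Types (A H K N : set G).

Definition subgroup H : Prop :=
  [/\ H 1%g,
      forall x y, H x -> H y -> H (x * y)%g
    & forall x, H x -> H (x^-1)%g].

Definition normal_subgroup N : Prop :=
  subgroup N /\ forall g x, N x -> N (g * x * g^-1)%g.

Definition normal_closure K : set G := smallest normal_subgroup K.

Definition left_coset g K : set G := [set (g * k)%g | k in K].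

(* [A : K] is infinite *)
Definition infinite_index A K : Prop :=
  infinite_set [set left_coset g K | g in A].

Definition finite_symmetric_generating_set (S : set G) : Prop :=
  [/\ finite_set S,
      forall c, S c -> S (c^-1)%g
    & smallest subgroup S = [set: G]].

End Groups.

Section PseudoMetric.
Variables (R : realType) (X : Type) (d : X -> X -> R).

(* Endpoints are prescribed up to distance 0, so that the notion depends only
   on the metric space obtained by identifying points at distance 0. *)
Definition geodesic (gamma : R -> X) (L : R) (x y : X) : Prop :=
  [/\ 0 <= L,
      d (gamma 0) x = 0,
      d (gamma L) y = 0
    & forall s t, 0 <= s <= L -> 0 <= t <= L ->
        d (gamma s) (gamma t) = `|s - t|].

(* Every side of a geodesic triangle lies in the closed delta-neighbourhood of
   the union of the two others; one side suffices, as triangles can be rotated. *)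
Definition slim_triangles (delta : R) : Prop :=
  forall (x y z : X) (a b c : R -> X) (La Lb Lc : R),
    geodesic a La x y -> geodesic b Lb y z -> geodesic c Lc z x ->
    forall s, 0 <= s <= La ->
      (exists2 t, 0 <= t <= Lb & d (a s) (b t) <= delta) \/
      (exists2 t, 0 <= t <= Lc & d (a s) (c t) <= delta).

Definition hyperbolic : Prop := exists2 delta, 0 <= delta & slim_triangles delta.

End PseudoMetric.

Section CayleyGraph.
Variables (R : realType) (G : groupType) (S : set G).

Definition cayley_edge (g h : G) : Prop := exists2 c, S c & h = (g * c)%g.

Definition cayley_walk (n : nat) (g h : G) : Prop :=
  exists p : seq G,
    [/\ path (fun a b => `[< cayley_edge a b >]) g p, last g p = h & size p = n].

(* [EdgePoint g c t _ _] is the point at distance t from g in the interior of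
   the edge from g to gc.  The same point is also named by the reversed edge, as
   [EdgePoint (gc) c^-1 (1 - t)]; see [cayley_dist_flip]. *)
Inductive cayley_point : Type :=
| Vertex of G
| EdgePoint (g c : G) (t : R) of S c & 0 < t < 1.

(* The vertices bounding the cell of x, with their distance to x in that cell. *)
Definition cell_ends (x : cayley_point) : set (G * R) :=
  match x with
  | Vertex g => [set (g, 0)]
  | EdgePoint g c t _ _ => [set (g, t); ((g * c)%g, 1 - t)]
  end.

(* Lengths of paths inside an open edge that contains both points.  When c = 1
   the edge is a loop, a circle of length 1: reversing it would not be a mere
   change of name since both names have the form [EdgePoint g 1 _]. *)
Definition direct_lengths (x y : cayley_point) : set R :=
  match x, y with
  | EdgePoint g c s _ _, EdgePoint h e t _ _ =>
      [set r | [/\ h = g, e = c & r = `|s - t|] \/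
               [/\ c <> 1%g, h = (g * c)%g, e = (c^-1)%g & r = `|s - (1 - t)|]]
  | _, _ => set0
  end.

Definition path_lengths (x y : cayley_point) : set R :=
  direct_lengths x y `|`
  [set r | exists v w n, [/\ cell_ends x v, cell_ends y w,
             cayley_walk n v.1 w.1 & r = v.2 + n%:R + w.2]].

(* The path metric on the geometric realization of the Cayley graph (a geodesic
   metric whenever S generates G). *)
Definition cayley_dist (x y : cayley_point) : R := inf (path_lengths x y).

Definition quasiconvex (H : set G) : Prop :=
  exists2 C : R, 0 <= C &
    forall (p q : G) (gamma : R -> cayley_point) (L : R), H p -> H q ->
      geodesic cayley_dist gamma L (Vertex p) (Vertex q) ->
      forall s, 0 <= s <= L ->
        exists2 h, H h & cayley_dist (gamma s) (Vertex h) <= C.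

Lemma path_lengths_ge0 x y r : path_lengths x y r -> 0 <= r.
Proof.
have ends0 z v : cell_ends z v -> 0 <= v.2.
  case: z => [g -> //|g c t _ /andP[t0 t1]] /= [->|->] /=; first exact: ltW.
  by rewrite subr_ge0 ltW.
case; last by move=> [v [w [n [/ends0 v0 /ends0 w0 _ ->]]]]; rewrite !addr_ge0.
by case: x y => [?|g c s _ _] [?|h e t _ _] //= [] [] => [|_] _ _ ->.
Qed.

Lemma cayley_dist_eq0 x y : path_lengths x y 0 -> cayley_dist x y = 0.
Proof.
move=> xy0; have lb0 : lbound (path_lengths x y) 0.
  by move=> r; exact: path_lengths_ge0.
apply/eqP; rewrite eq_le; apply/andP; split.
  by apply: ge_inf xy0; exists 0.
by apply: lb_le_inf lb0; exists 0.
Qed.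

Lemma cayley_dist_xx x : cayley_dist x x = 0.
Proof.
apply: cayley_dist_eq0; case: x => [g|g c t ? ?].
  by right; exists (g, 0), (g, 0), 0%N; rewrite !addr0; split=> //; exists [::].
by left; left; rewrite subrr normr0.
Qed.

Lemma cayley_dist_flip g c t (Sc : S c) (Sc' : S (c^-1)%g)
    (t01 : 0 < t < 1) (t01' : 0 < 1 - t < 1) : c <> 1%g ->
  cayley_dist (EdgePoint g Sc t01) (EdgePoint (g * c)%g Sc' t01') = 0.
Proof.
by move=> c1; apply: cayley_dist_eq0; left; right; rewrite subKr subrr normr0.
Qed.

End CayleyGraph.

(* Main.v *)
(* Suppose that N = K^G contains K with finite index.  Then N lies in a bounded
   neighbourhood of H.  An infinite subgroup of a hyperbolic group cannot have a
   single limit direction: otherwise either some x in N translates towards it, and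
   the powers of x^-1 go to infinity without approaching it, or every x in N moves
   the points far out in that direction by a uniformly bounded amount, which
   contradicts the finiteness of balls.  So there are pairs n, n' in N arbitrarily
   far from 1 whose Gromov product at 1 is bounded.  For g in G, the points
   g n and g n' are at distance |g| from g n g^-1 and g n' g^-1, which are in N,
   hence near H.  As n and n' are much longer than g, a geodesic between the nearby
   points of H passes at bounded distance from g, and by quasiconvexity g is at
   distance from H bounded independently of g, so that H has finite index. *)
Require Import Defs.
From mathcomp Require Import all_boot all_order all_algebra.
From mathcomp Require Import finmap.
From mathcomp Require Import boolp classical_sets functions cardinality reals.
From mathcomp Require Import zify lra.

Set Implicit Arguments.
Unset Strict Implicit.
Unset Printing Implicit Defensive.

Import Order.TTheory GRing.Theory Num.Theory.

Local Open Scope classical_set_scope.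

(** * From slim triangles to the four-point inequality, in an integer-valued metric *)

Section SlimToFourPoint.
Local Open Scope nat_scope.
Variables (G : Type) (d : G -> G -> nat).
Hypothesis dxx : forall x, d x x = 0.
Hypothesis dC : forall x y, d x y = d y x.
Hypothesis dT : forall x y z, d x z <= d x y + d y z.

Definition isometric_path (f : nat -> G) x y := [/\ f 0 = x, f (d x y) = y &
  forall i j, i <= j <= d x y -> d (f i) (f j) = j - i].

(** Only one side is a chosen path: [q] is placed on the others by equality in the triangle
    inequality, which leaves their geodesics unnamed. *)
Definition discrete_slim (delta : nat) := forall x y z f, isometric_path f x y ->
  forall i, i <= d x y -> exists2 q, d (f i) q <= delta &
    d y q + d q z = d y z \/ d z q + d q x = d z x.

(** Discrete continuity along [f]: the start is close to the side [x w], so either the end [y] is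
    too, or there is an index close to that side whose successor is not, and slimness puts the
    successor close to [y w]. Stepping back from the successor costs the extra 1 in [delta.+1]. *)
Lemma tripod_centre delta x y w f : discrete_slim delta -> isometric_path f x y ->
  exists i q1 q2, [/\ i <= d x y, d (f i) q1 <= delta, d (f i) q2 <= delta.+1,
    d x q1 + d q1 w = d x w & d y q2 + d q2 w = d y w].
Proof.
move=> slim fP; have [f0 fL fE] := fP.
pose P i := exists2 q, d (f i) q <= delta & d x q + d q w = d x w.
have P0 : P 0 by exists x; rewrite ?f0 ?dxx.
have switch n : P n \/ exists i, [/\ i < n, P i & ~ P i.+1].
  elim: n => [|n [Pn|[i [lt_in Pi nPi]]]]; first by left.
    have [PS|nPS] := pselect (P n.+1); first by left.
    by right; exists n; split.
  by right; exists i; split=> //; apply: ltnW.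
case: (switch (d x y)) => [[q1 fq1 xq1]|[i [iL [q1 fq1 xq1] nPi]]].
  by exists (d x y), q1, y; rewrite fq1 fL dxx.
have [q2 fq2 [yq2|wq2]] := slim x y w f fP i.+1 iL.
  exists i, q1, q2; split=> //; first exact: ltnW.
  by have := dT (f i) (f i.+1) q2; rewrite fE; lia.
by case: nPi; exists q2 => //; rewrite addnC (dC q2) (dC x) wq2 dC.
Qed.

(** The centre [f i] of the triangle [x y w] lies on [x y] and is close to [x w] and [y w]. Slimness
    of [x y z] at [f i] puts it close to [y z] or [z x] as well, and the two cases give the two
    alternatives. The disjunction stands for the maximum in Gromov's four-point condition. *)
Lemma slim_four_point delta :
  (forall x y, exists f, isometric_path f x y) -> discrete_slim delta ->
  forall x y z w,
    d x y + d z w <= d x z + d y w + (6 * delta + 2) \/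
    d x y + d z w <= d x w + d y z + (6 * delta + 2).
Proof.
move=> geo slim x y z w; have [f fP] := geo x y; have [f0 fL fE] := fP.
have [i [q1 [q2 [iL fq1 fq2 xq1 yq2]]]] := tripod_centre w slim fP.
have [q fq qz] := slim x y z f fP i iL.
have xi := fE 0 i; have iy := fE i (d x y); rewrite f0 fL in xi iy.
have := xi ltac:(lia); have := iy ltac:(lia).
have := dT x q1 (f i); have := dT y q2 (f i).
have := dT (f i) q1 w; have := dT (f i) q2 w; have := dT q (f i) w.
have := dT x q w; have := dT y q w; have := dT z q w.
rewrite (dC q1 (f i)) (dC q2 (f i)) (dC q (f i)) (dC y (f i)) (dC z q) (dC x q).
move: qz xq1 yq2 fq1 fq2 fq; rewrite (dC y q) (dC z q) (dC z x); lia.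
Qed.

End SlimToFourPoint.

(** * The word metric: invariance, finite balls, discrete geodesics *)

Section WordMetric.
Local Open Scope nat_scope.
Variables (G : groupType) (S : set G).
Implicit Types x y z g : G.

Lemma cayley_walk0 g : cayley_walk S 0 g g.
Proof. by exists [::]. Qed.

Lemma cayley_walkS n g h : cayley_walk S n.+1 g h <->
  exists2 c, S c & cayley_walk S n (g * c)%g h.
Proof.
split=> [[[|k p] [//= /andP[/asboolP[c Sc ->] pp] pl [ps]]]|[c Sc [p [pp pl ps]]]].
  by exists c => //; exists p.
exists (g * c :: p)%g; split=> //=; last by rewrite ps.
by rewrite pp andbT; apply/asboolP; exists c.
Qed.

Lemma cayley_walk_cat m n x y z :
  cayley_walk S m x y -> cayley_walk S n y z -> cayley_walk S (m + n) x z.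
Proof.
elim: m x => [|m IH] x.
  by case=> p [pp <- /size0nil p0]; rewrite p0.
by move=> /cayley_walkS[c Sc xy] yz; apply/cayley_walkS; exists c => //; apply: IH.
Qed.

Lemma cayley_walk_mull g n x y :
  cayley_walk S n x y -> cayley_walk S n (g * x)%g (g * y)%g.
Proof.
elim: n x => [|n IH] x.
  by case=> p [pp <- /size0nil p0]; rewrite p0; apply: cayley_walk0.
move=> /cayley_walkS[c Sc /IH xy]; apply/cayley_walkS; exists c => //.
by rewrite -mulgA.
Qed.

Lemma cayley_walk_sub n x y : cayley_walk S n x y ->
  exists f : nat -> G, [/\ f 0 = x, f n = y &
    forall i j, i <= j <= n -> cayley_walk S (j - i) (f i) (f j)].
Proof.
elim: n x => [|n IH] x.
  case=> p [pp <- /size0nil p0]; exists (fun=> x); rewrite p0.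
  split=> // i j ij; have -> : j - i = 0 by lia.
  exact: cayley_walk0.
move=> /cayley_walkS[c Sc /IH[f [f0 fn fw]]].
exists (fun i => if i is j.+1 then f j else x); split=> // -[|i] [|j] //= ij.
- exact: cayley_walk0.
- by apply/cayley_walkS; exists c => //; have := fw 0 j ij; rewrite subn0 f0.
- by rewrite subSS; apply: fw.
Qed.

(* Junk value 0 when [y] cannot be reached from [x]. *)
Definition word_dist x y : nat :=
  xget 0 [set n | cayley_walk S n x y /\ forall m, cayley_walk S m x y -> n <= m].

Hypothesis gen : finite_symmetric_generating_set S.

Lemma cayley_walk_sym n x y : cayley_walk S n x y -> cayley_walk S n y x.
Proof.
have [_ SV _] := gen; elim: n x => [|n IH] x.
  by case=> p [pp <- /size0nil p0]; rewrite p0; apply: cayley_walk0.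
move=> /cayley_walkS[c Sc /IH yx]; rewrite -addn1; apply: (cayley_walk_cat yx).
apply/cayley_walkS; exists c^-1%g; first exact: SV.
by rewrite mulgK; apply: cayley_walk0.
Qed.

Lemma cayley_connected x y : exists n, cayley_walk S n x y.
Proof.
have [_ _ Sgen] := gen.
have walk1 g : exists n, cayley_walk S n 1%g g.
  have : [set: G] g by [].
  rewrite -Sgen; move: g; apply: (@smallest_sub _ _ _ [set g | exists n, _]).
    split=> [|g h [m mg] [n nh]|g [n ng]] /=; first by exists 0; apply: cayley_walk0.
      exists (m + n); apply: (cayley_walk_cat mg).
      by have := cayley_walk_mull g nh; rewrite mulg1.
    exists n; apply: cayley_walk_sym.
    by have := cayley_walk_mull g^-1%g ng; rewrite mulg1 mulVg.
  move=> c Sc; exists 1; apply/cayley_walkS; exists c => //.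
  by rewrite mul1g; apply: cayley_walk0.
have [n /(cayley_walk_mull x)] := walk1 (x^-1 * y)%g.
by rewrite mulg1 mulVKg; exists n.
Qed.

Lemma word_distP x y : cayley_walk S (word_dist x y) x y /\
  forall m, cayley_walk S m x y -> word_dist x y <= m.
Proof.
rewrite /word_dist; case: xgetP => [n _ //|H]; exfalso.
have ex : exists n, `[< cayley_walk S n x y >].
  by have [n nP] := cayley_connected x y; exists n; apply/asboolP.
case: (ex_minnP ex) => n /asboolP nP nmin; apply: (H n).
by split=> // m mP; apply: nmin; apply/asboolP.
Qed.

Lemma word_dist_le n x y : cayley_walk S n x y -> word_dist x y <= n.
Proof. exact: (word_distP x y).2. Qed.

Lemma word_dist_walk x y : cayley_walk S (word_dist x y) x y.
Proof. exact: (word_distP x y).1. Qed.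

Lemma word_distxx x : word_dist x x = 0.
Proof. by apply/eqP; rewrite -leqn0; apply/word_dist_le/cayley_walk0. Qed.

Lemma word_dist_eq0 x y : word_dist x y = 0 -> x = y.
Proof.
by move=> E; have := word_dist_walk x y; rewrite E => -[p [_ <- /size0nil->]].
Qed.

Lemma word_distC x y : word_dist x y = word_dist y x.
Proof.
by apply/eqP; rewrite eqn_leq !word_dist_le //;
  apply/cayley_walk_sym/word_dist_walk.
Qed.

Lemma word_dist_triangle x y z : word_dist x z <= word_dist x y + word_dist y z.
Proof. exact/word_dist_le/(cayley_walk_cat (word_dist_walk _ _))/word_dist_walk. Qed.

Lemma word_dist_mull g x y : word_dist (g * x)%g (g * y)%g = word_dist x y.
Proof.
apply/eqP; rewrite eqn_leq; apply/andP; split; apply: word_dist_le.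
  exact/cayley_walk_mull/word_dist_walk.
by have := cayley_walk_mull g^-1%g (word_dist_walk (g * x)%g (g * y)%g); rewrite !mulKg.
Qed.

Lemma word_ball_finite n : finite_set [set x | word_dist 1%g x <= n].
Proof.
have [Sfin _ _] := gen; elim: n => [|n IH].
  apply: (sub_finite_set _ (finite_set1 1%g)) => x /=.
  by rewrite leqn0 => /eqP/word_dist_eq0.
apply: (sub_finite_set (B := [set x | word_dist 1%g x <= n] `|`
  [set (x * c)%g | x in [set x | word_dist 1%g x <= n] & c in S])).
  move=> x /= xn; have [|lt] := leqP (word_dist 1%g x) n; first by left.
  have [f [f0 fL fw]] := cayley_walk_sub (word_dist_walk 1%g x).
  have E : word_dist 1%g x = n.+1 by lia.
  rewrite E in fL fw; right; exists (f n).
    by apply: word_dist_le; have := fw 0 n (leqnSn n); rewrite subn0 f0.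
  have := fw n n.+1; rewrite leqnSn leqnn subSnn fL => /(_ isT)/cayley_walkS[c Sc].
  by case=> p [_ <- /size0nil ->]; exists c.
by rewrite finite_setU; split=> //; apply: finite_image2.
Qed.

(** Subwalks of a shortest walk bound the distances above; a shortcut between two of its vertices
    would contradict the triangle inequality. *)
Lemma word_geodesic x y : exists f, isometric_path word_dist f x y.
Proof.
have [f [f0 fL fw]] := cayley_walk_sub (word_dist_walk x y); exists f.
split=> // i j /andP[ij jL]; apply/eqP; rewrite eqn_leq.
rewrite word_dist_le /=; last by apply: fw; lia.
have := word_dist_le (fw 0 i ltac:(lia)).
have := word_dist_le (fw j (word_dist x y) ltac:(lia)).
rewrite f0 fL; have := word_dist_triangle x (f i) y.
have := word_dist_triangle (f i) (f j) y; lia.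
Qed.

End WordMetric.

(** * Limit directions of subgroups under an invariant four-point metric with finite balls *)

Section HyperbolicLength.
Local Open Scope nat_scope.
Variables (G : groupType) (d : G -> G -> nat) (D : nat).
Implicit Types (x y z w g : G) (N : set G).

Hypothesis dxx : forall x, d x x = 0.
Hypothesis dC : forall x y, d x y = d y x.
Hypothesis dT : forall x y z, d x z <= d x y + d y z.
Hypothesis dM : forall g x y, d (g * x)%g (g * y)%g = d x y.
Hypothesis ball_finite : forall n, finite_set [set x | d 1%g x <= n].
Hypothesis d_between : forall x y t, t <= d x y ->
  exists p, d x p = t /\ d p y = d x y - t.
Hypothesis d4 : forall x y z w,
  d x y + d z w <= d x z + d y w + D \/ d x y + d z w <= d x w + d y z + D.

(* [lia] fails to identify distances whose points are convertible but not
   syntactically equal, hence the generalization of the distances. *)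
Ltac dlia :=
  repeat match goal with
  | H : is_true _ |- _ => move: H
  | H : @eq nat _ _ |- _ => move: H
  end;
  repeat match goal with |- context [d ?x ?y] => move: (d x y) => ? end;
  lia.

Lemma dMV g x y : d (g^-1 * x)%g y = d x (g * y)%g.
Proof. by rewrite -(dM g) mulVKg. Qed.

Lemma dMl g x y : d (g * x)%g y = d x (g^-1 * y)%g.
Proof. by rewrite -(dM g^-1%g) mulKg. Qed.

Lemma dMr x y : d x (x * y)%g = d 1%g y.
Proof. by rewrite -[X in d X]mulg1 dM. Qed.

Lemma dV1 x : d 1%g x^-1%g = d 1%g x.
Proof. by rewrite dC -[x^-1%g]mulg1 dMV mulg1. Qed.

Lemma infinite_set_far N R : infinite_set N -> exists2 z, N z & R <= d 1%g z.
Proof.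
move=> Ninf; apply: contrapT => H; apply: Ninf.
apply: (sub_finite_set _ (ball_finite R)) => x Nx /=.
by case: (leqP R (d 1%g x)) => [?|/ltnW//]; case: H; exists x.
Qed.

(* [m <= 2 (x | y)] for the Gromov product based at 1. *)
Definition gromov_ge m x y := d x y + m <= d 1%g x + d 1%g y.

(** This says, without constructing the boundary at infinity, that [N] has at most one limit point
    there. *)
Definition single_direction N := forall m, exists R, forall x y, N x -> N y ->
  R <= d 1%g x -> R <= d 1%g y -> gromov_ge m x y.

(** Up to [D], the difference of [d x z] and [d 1 z] does not depend on the far point [z]: it is a
    coarse Busemann function of the limit direction. The product bound is chosen so large that the
    other alternative of [d4] would violate the triangle inequality for [1, x, z]. *)
Lemma busemann_far N x : subgroup N -> single_direction N -> N x ->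
  exists R, forall z w, N z -> N w -> R <= d 1%g z -> R <= d 1%g w ->
    d x z + d 1%g w <= d x w + d 1%g z + D.
Proof.
move=> Ngp Nsd Nx; have [R HR] := Nsd (d 1%g x + d 1%g x + D + 1)%N.
exists R => z w Nz Nw Rz Rw; have := HR z w Nz Nw Rz Rw; rewrite /gromov_ge => zw.
have := dT 1%g x z; have := d4 x z 1%g w; rewrite !(dC x 1%g) !(dC z 1%g); dlia.
Qed.

Lemma subgroupX N x k : subgroup N -> N x -> N (x ^+ k)%g.
Proof.
case=> N1 NM _ Nx; elim: k => [|k IH]; first by rewrite expg0.
by rewrite expgS; apply: NM.
Qed.

(* The powers of [x^-1] recede from the direction that [x] moves towards, at
   bounded Gromov product with it. *)
Lemma no_translation N x R : subgroup N -> infinite_set N -> single_direction N ->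
  N x -> (forall z, N z -> R <= d 1%g z -> d x z + D.+1 <= d 1%g z) -> False.
Proof.
move=> Ngp Ninf Nsd Nx Hx; have [N1 NM NV] := Ngp.
have step w : N w -> R + d 1%g x <= d 1%g w -> d 1%g w + D.+1 <= d 1%g (x * w)%g.
  move=> Nw Rw; have Nxw := NM _ _ Nx Nw; have := dT x 1%g (x * w)%g.
  have Exw : d x (x * w)%g = d 1%g w by rewrite dMr.
  have := Hx _ Nxw; rewrite Exw (dC x 1%g).
  dlia.
have far k z : N z -> R + d 1%g x <= d 1%g z ->
    d 1%g z + k <= d 1%g (x ^+ k * z)%g.
  move=> Nz Rz; elim: k => [|k IH]; first by rewrite expg0 mul1g addn0.
  rewrite expgS -mulgA.
  have := step _ (NM _ _ (subgroupX k Ngp Nx) Nz); dlia.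
(* Twice the Gromov product of [x^-k] and [z] is at most [d 1 x + D] for every [k]. Translating by
   [x] turns the case of [k+1] and [z] into a comparison with the case of [k] and [x z]; both
   alternatives of [d4] suffice because [x z] is longer than [z] by more than [D]. *)
have bounded k z : N z -> R + d 1%g x <= d 1%g z ->
    d 1%g (x ^- k)%g + d 1%g z <= d (x ^- k)%g z + (d 1%g x + D).
  elim: k z => [|k IH] z Nz Rz; first by rewrite expg0 invg1 dxx; dlia.
  have Nxz := NM _ _ Nx Nz; have hz := step _ Nz Rz.
  have := IH _ Nxz; rewrite expgSr invgM; set u := (x ^- k)%g.
  rewrite dMV (dC _ (x^-1 * u)%g) dMV mulg1.
  have Exz : d x (x * z)%g = d 1%g z by rewrite dMr.
  have := Hx _ Nxz; rewrite Exz.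
  have := d4 u x 1%g (x * z)%g; rewrite Exz (dC u 1%g) (dC x 1%g).
  dlia.
(* The radius [R2] also serves as the exponent: by [far], [x ^+ R2] has length at least [R2], so its
   inverse is far enough for [HR2], whose product bound is one more than [bounded] allows. *)
have [R2 HR2] := Nsd (d 1%g x + D).+1.
have [z Nz zfar] := infinite_set_far (R + d 1%g x + R2) Ninf.
have Nk := NV _ (subgroupX R2 Ngp Nx).
have := bounded R2 z Nz; have := far R2 z Nz; have := HR2 _ z Nk Nz.
rewrite /gromov_ge; have := dT 1%g (x ^+ R2)%g (x ^+ R2 * z)%g; rewrite dMr dV1.
dlia.
Qed.

(* Far along a geodesic in the limit direction, all of [N] moves points by a
   bounded amount. *)
Lemma bounded_displacement N B (X : seq G) :
  subgroup N -> infinite_set N -> single_direction N ->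
  (forall x, x \in X -> N x) ->
  (forall x, N x -> exists R, forall z, N z -> R <= d 1%g z ->
     d 1%g z <= d x z + B) ->
  exists p, forall x, x \in X -> d p (x * p)%g <= B + D + D.
Proof.
move=> Ngp Ninf Nsd XN NB; have [N1 NM NV] := Ngp.
have [T XT] : exists T, forall x, x \in X -> d 1%g x <= T.
  by exists (\max_(x <- X) d 1%g x) => x xX; apply: leq_bigmax_seq.
have [R1 HR1] := Nsd (T + T).
have [R2 HR2] : exists R2, forall x, x \in X -> forall z, N z -> R2 <= d 1%g z ->
    d 1%g z <= d x z + B /\ d 1%g z <= d (x^-1)%g z + B.
  elim: X XN {T XT R1 HR1} => [|x X IH] XN; first by exists 0.
  have [|R2 HR2] := IH; first by move=> y yX; apply: XN; rewrite inE yX orbT.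
  have Nx : N x by apply: XN; rewrite mem_head.
  have [Ra Ha] := NB _ Nx; have [Rb Hb] := NB _ (NV _ Nx).
  exists (Ra + Rb + R2) => y; rewrite inE => /orP[/eqP->|yX] z Nz Rz.
    by split; [apply: Ha|apply: Hb] => //; dlia.
  by apply: HR2 => //; dlia.
have [z Nz zfar] := infinite_set_far (R1 + R2 + T + T) Ninf.
(* The point [p] lies on the way from 1 to [z] at height [T], which is at least the length of every
   [x] in [X]. The estimates [a1] and [a2] show that [x p] is at most [B + D] further than [p] from
   1 and from [z]; a last use of [d4] then makes [p] and [x p] close. *)
have [|p [p1 p2]] := @d_between 1%g z T; first by dlia.
exists p => x xX; have Nx := XN _ xX; have xT := XT _ xX.
pose w := (x^-1 * z)%g; have Nw : N w by apply: NM => //; apply: NV.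
have wz : d x z = d 1%g w by rewrite /w (dC _ (x^-1 * z)%g) dMV mulg1 dC.
have vT := dV1 x.
have xz : d (x^-1)%g z = d 1%g (x * z)%g by rewrite -[x^-1%g]mulg1 dMV.
have wfar : R1 + R2 + T <= d 1%g w by have := dT 1%g x z; dlia.
have xzfar : R2 <= d 1%g (x * z)%g.
  by have := dT 1%g (x^-1)%g z; dlia.
have [_ bw] := HR2 x xX w Nw ltac:(dlia).
have [bxz _] := HR2 x xX _ (NM _ _ Nx Nz) xzfar.
have wz' : d (x^-1)%g w = d 1%g z by rewrite /w -{1}[x^-1%g]mulg1 dM.
have xxz : d x (x * z)%g = d 1%g z by rewrite dMr.
have a1 : d 1%g (x * p)%g <= T + B + D.
  have -> : d 1%g (x * p)%g = d p (x^-1)%g by rewrite dC dMl mulg1.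
  have := d4 p (x^-1)%g 1%g z; rewrite (dC p 1%g) (dC _ 1%g); dlia.
have a2 : d (x * p)%g z <= d 1%g z - T + B + D.
  rewrite dMl -/w; have := HR1 w z Nw Nz; rewrite /gromov_ge.
  have := d4 p w z 1%g; rewrite (dC p 1%g) (dC w 1%g) (dC z 1%g).
  have := dC p w; dlia.
have := d4 p (x * p)%g 1%g z; rewrite (dC p 1%g) (dC (x * p)%g 1%g); dlia.
Qed.

Lemma two_directions N : subgroup N -> infinite_set N -> ~ single_direction N.
Proof.
move=> Ngp Ninf Nsd; have [N1 NM NV] := Ngp.
(* If the bound failed at one far [z], [busemann_far] would carry the failure to all far [w] at a
   loss of [D], leaving the drop of [D.+1] that [no_translation] excludes. *)
have NB x : N x -> exists R, forall z, N z -> R <= d 1%g z ->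
    d 1%g z <= d x z + (D + D.+1).
  move=> Nx; have [R HR] := busemann_far Ngp Nsd Nx.
  exists R => z Nz Rz; case: (leqP (d 1%g z) (d x z + (D + D.+1))) => // far.
  exfalso; apply: (@no_translation N x R) => // w Nw Rw.
  have := HR w z Nw Nz Rw Rz; dlia.
(* The ball is fixed before [X] and [p]. Conjugation by [p] is injective and maps [X], which has
   more elements than the ball, into it. *)
have [F FC] := (finite_seqP _).1 (ball_finite (D + D.+1 + D + D)).
have [X XN sX] := infinite_set_fset (size F).+1 Ninf.
have [p Hp] := bounded_displacement Ngp Ninf Nsd XN NB.
have: size [seq p^-1 * x * p | x <- enum_fset X]%g <= size F.
  apply: uniq_leq_size.
    rewrite map_inj_uniq ?fset_uniq // => x y /mulIg/mulgI //.
  move=> _ /mapP[x xX ->]; have : [set` F] (p^-1 * x * p)%g.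
    by rewrite -FC /= -(dMr p) -!mulgA mulVKg; apply: Hp.
  by [].
by rewrite size_map leqNgt sX.
Qed.

Lemma near_quasiconvex_overgroup (H N : set G) (E C : nat) :
  normal_subgroup N -> infinite_set N ->
  (forall n, N n -> exists2 h, H h & d n h <= E) ->
  (forall p q t, H p -> H q -> t <= d p q -> exists r h,
     [/\ H h, d p r = t, d r q = d p q - t & d r h <= C]) ->
  exists B, forall g, exists2 h, H h & d g h <= B.
Proof.
move=> [Ngp Nn] Ninf NE HC.
have [m Hm] : exists m, forall R, exists x y,
    [/\ N x, N y, R <= d 1%g x, R <= d 1%g y & d 1%g x + d 1%g y < d x y + m].
  apply: contrapT => H0; apply: (two_directions Ngp Ninf) => m.
  apply: contrapT => H1; apply: H0; exists m => R.
  apply: contrapT => H2; apply: H1; exists R => x y Nx Ny Rx Ry.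
  rewrite /gromov_ge leqNgt; apply/negP => lt; apply: H2.
  by exists x, y.
exists (m + D + D + D + C) => g.
(* This length lets [g x] and [g y] be replaced by [p] and [q] in [H], at distance at most
   [d 1 g + E], at the cost of only [D] each: the alternative of [d4] that would involve [d 1 g] is
   impossible for such long elements. Hence the final bound does not depend on [g]. *)
have [x [y [Nx Ny Rx Ry xy]]] := Hm (d 1%g g + d 1%g g + E + E + D + D + m).
have near z : N z -> exists2 h, H h & d (g * z)%g h <= d 1%g g + E.
  move=> Nz; have [h Hh hE] := NE _ (Nn g _ Nz); exists h => //.
  have := dT (g * z)%g (g * z * g^-1)%g h.
  rewrite dMr dV1; dlia.
have [p Hp gp] := near _ Nx; have [q Hq gq] := near _ Ny.
have gx := dMr g x; have gy := dMr g y.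
have pq : d g p + d g q < d p q + m + D + D.
  have := dM g x y.
  have := d4 (g * x)%g (g * y)%g g p; have := d4 p (g * y)%g g q.
  have := dT g p (g * x)%g; have := dT g q (g * y)%g.
  rewrite !(dC _ g) (dC p (g * x)%g) (dC q (g * y)%g) (dC p (g * y)%g); dlia.
(* The point [r] between [p] and [q] is as far from [p] as [g] is, capped at [q]; by [pq], [g]
   nearly lies between [p] and [q], so [d4] makes [r] close to [g]. *)
have [|r [h [Hh pr rq rh]]] := HC p q (minn (d p q) (d g p)) Hp Hq.
  exact: geq_minl.
exists h => //; have := dT g r h; have := d4 g r p q.
have := dT g p q; have := dT p g q; have := dT g q p.
rewrite (dC r p) (dC p g) (dC q p); dlia.
Qed.

(** If [h] in [H] is close to the inverse of [g], then [g h] is a short representative of the coset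
    of [g]; balls are finite. *)
Lemma near_finite_index (H : set G) B : subgroup H ->
  (forall g, exists2 h, H h & d g h <= B) -> ~ infinite_index [set: G] H.
Proof.
move=> [H1 HM HV] HB; apply.
apply: (sub_finite_set (B := [set left_coset g H | g in [set x | d 1%g x <= B]])).
  2: exact: finite_image.
move=> _ [g _ <-]; have [h Hh gh] := HB g^-1%g.
exists (g * h)%g => /=; first by rewrite -[g]invgK -dMl mulg1.
apply/seteqP; split=> _ [k Hk <-].
  by exists (h * k)%g; rewrite ?mulgA //; apply: HM.
by exists (h^-1 * k)%g; [apply: HM => //; apply: HV | rewrite mulgA mulgK].
Qed.

End HyperbolicLength.

(** * Passage between the geometric Cayley graph and the word metric *)

Section Realization.
Local Open Scope ring_scope.
Variables (R : realType) (G : groupType) (S : set G).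
Hypothesis gen : finite_symmetric_generating_set S.
Local Notation d := (word_dist S).

Lemma path_lengthsC (x y : cayley_point R S) r :
  path_lengths x y r -> path_lengths y x r.
Proof.
case=> [|[v [w [n [xv yw vw ->]]]]]; last first.
  right; exists w, v, n; split=> //; first exact: cayley_walk_sym.
  by lra.
case: x y => [?|g c s Sc s01] [?|h e t Se t01] // H; left; case: H => /=.
  by case=> -> -> ->; left; rewrite distrC.
case=> c1 -> -> ->; right; rewrite mulgK invgK; split=> //.
  by move=> /(canRL (@invgK _)); rewrite invg1.
by congr `|_|; lra.
Qed.

Lemma path_lengths_nonempty (x y : cayley_point R S) : path_lengths x y !=set0.
Proof.
have end_ex (z : cayley_point R S) : exists v, cell_ends z v.
  by case: z => [g|g c t Sc t01]; [exists (g, 0)|exists (g, t); left].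
have [v xv] := end_ex x; have [w yw] := end_ex y.
have [n vw] := cayley_connected gen v.1 w.1.
by exists (v.2 + n%:R + w.2); right; exists v, w, n.
Qed.

Lemma cayley_dist_min (x y : cayley_point R S) r :
  path_lengths x y r -> (forall u, path_lengths x y u -> r <= u) ->
  cayley_dist x y = r.
Proof.
move=> xyr lb; apply/eqP; rewrite eq_le; apply/andP; split.
  by apply: ge_inf xyr; exists r.
by apply: lb_le_inf => //; exists r.
Qed.

(** The infimum is approached within 1 by the length of a path through an end of the cell of [x],
    whence the [r + 1]; no path inside an open edge starts at a vertex. *)
Lemma cayley_dist_vertex g (x : cayley_point R S) r :
  cayley_dist (Vertex R S g) x <= r ->
  exists2 v, cell_ends x v & (d g v.1)%:R <= r + 1.
Proof.
move=> gx; have lb : has_inf (path_lengths (Vertex R S g) x).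
  by split; [apply: path_lengths_nonempty | exists 0 => u; apply: path_lengths_ge0].
have [u] := inf_adherent ltr01 lb; rewrite -/(cayley_dist _ _) => gu ur.
case: gu => [|[v [w [n [/= -> xw gw uE]]]]]; first by case: x {gx lb ur}.
exists w => //; have := word_dist_le gen gw; rewrite -(ler_nat R) => le_n.
have w0 : 0 <= w.2.
  case: x xw {gx lb ur} => [?|? ? t Sc t01] /=; first by move=> ->.
  by case/andP: t01 => t0 t1 [->|->] /=; rewrite ?subr_ge0 ltW.
by move: uE => /=; lra.
Qed.

Lemma isometric_path_edge f x y i : isometric_path d f x y ->
  (i < d x y)%N -> S ((f i)^-1 * f i.+1)%g.
Proof.
move=> [_ _ fE] iL; have := word_dist_walk gen (f i) (f i.+1).
rewrite fE ?subSnn ?leqnSn // => /cayley_walkS[c Sc [p [_ /= + /size0nil p0]]].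
by rewrite p0 => /= <-; rewrite mulKg.
Qed.

Section Geodesic.
Variables (x y : G) (f : nat -> G).
Hypothesis fP : isometric_path d f x y.

(* The last branch is reached only at integers and outside [0, d x y]. *)
Definition realize (s : R) : cayley_point R S :=
  let i := Num.truncn s in
  match pselect (S ((f i)^-1 * f i.+1)%g), pselect (0 < s - i%:R < 1) with
  | left Sc, left t01 => EdgePoint (f i) Sc t01
  | _, _ => Vertex R S (f i)
  end.

Lemma realize_nat i : realize i%:R = Vertex R S (f i).
Proof.
rewrite /realize natrK; case: pselect => // Sc; case: pselect => // t01.
by exfalso; move: t01; rewrite subrr ltxx.
Qed.

Lemma realize_edge i (s : R) : (i < d x y)%N -> i%:R < s < i.+1%:R ->
  exists Sc t01, realize s =
    @EdgePoint R G S (f i) ((f i)^-1 * f i.+1)%g (s - i%:R) Sc t01.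
Proof.
move=> iL /andP[lt_is lt_si].
have si : Num.truncn s = i by apply: truncn_def; rewrite ltW.
rewrite /realize si; case: pselect => [Sc|].
  2: by case; apply: isometric_path_edge fP iL.
case: pselect => [t01|]; first by exists Sc, t01.
by case; move: lt_si; rewrite -natr1; lra.
Qed.

Lemma realizeP (s : R) : 0 <= s <= (d x y)%:R ->
  (exists2 i, (i <= d x y)%N & s = i%:R) \/
  (exists2 i, (i < d x y)%N & i%:R < s < i.+1%:R).
Proof.
move=> /andP[s0 sL]; have /andP[le_is lt_si] := truncn_itv s0.
set i := Num.truncn s in le_is lt_si *.
have [E|ne] := eqVneq s i%:R; first by left; exists i; rewrite // -(ler_nat R) -E.
have lt_is : i%:R < s by rewrite lt_neqAle eq_sym ne.
right; exists i; last by rewrite lt_is.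
by rewrite -(ltr_nat R); apply: lt_le_trans sL.
Qed.

Lemma realize_ends (s : R) v : 0 <= s <= (d x y)%:R -> cell_ends (realize s) v ->
  exists i, [/\ (i <= d x y)%N, v.1 = f i & v.2 = `|s - i%:R|].
Proof.
move=> /realizeP[[i iL ->]|[i iL si]].
  by rewrite realize_nat => -> /=; exists i; rewrite subrr normr0.
have [Sc [t01 ->]] := realize_edge iL si; move: si; rewrite -natr1 => /andP[si1 si2].
case=> -> /=; [exists i | exists i.+1]; split=> //=.
- exact: ltnW.
- by rewrite ger0_norm //; lra.
- by rewrite mulVKg.
- by rewrite -natr1 ler0_norm; lra.
Qed.

Lemma realize_left_end (s : R) : 0 <= s <= (d x y)%:R ->
  exists i, [/\ (i <= d x y)%N, i%:R <= s < i.+1%:R &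
    cell_ends (realize s) (f i, s - i%:R)].
Proof.
move=> /realizeP[[i iL ->]|[i iL si]]; exists i.
  by rewrite realize_nat subrr; split=> //; rewrite lexx ltr_nat leqnn.
have [Sc [t01 ->]] := realize_edge iL si; split; [exact: ltnW| |by left].
by move: si => /andP[/ltW-> ->].
Qed.

Lemma realize_right_end (s : R) : 0 <= s <= (d x y)%:R ->
  exists i, [/\ (i <= d x y)%N, s <= i%:R < s + 1 &
    cell_ends (realize s) (f i, i%:R - s)].
Proof.
move=> /realizeP[[i iL ->]|[i iL si]].
  by exists i; rewrite realize_nat subrr; split=> //; rewrite lexx ltrDl ltr01.
have [Sc [t01 ->]] := realize_edge iL si; exists i.+1; split=> //.
  by move: si; rewrite -natr1; lra.
by right; rewrite mulVKg -natr1; congr (_, _); lra.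
Qed.

Lemma isometric_path_inj i j : (i <= d x y)%N -> (j <= d x y)%N ->
  f i = f j -> i = j.
Proof.
have [_ _ fE] := fP; move=> iL jL E; have := fE i j; have := fE j i.
rewrite E word_distxx //; lia.
Qed.

(** A path through cell ends [f i] and [f j] has length at least the sum of the gaps from [s] to
    [i], [i] to [j] and [j] to [t]. Otherwise both points lie in one open edge. *)
Lemma realize_le (s t r : R) : 0 <= s <= (d x y)%:R -> 0 <= t <= (d x y)%:R ->
  path_lengths (realize s) (realize t) r -> `|s - t| <= r.
Proof.
move=> sL tL [|[v [w [n [sv tw vw ->]]]]]; last first.
  have [i [iL v1 ->]] := realize_ends sL sv; have [j [jL w1 ->]] := realize_ends tL tw.
  have := word_dist_le gen vw; rewrite v1 w1 => ij_n.
  have ij : `|i%:R - j%:R| <= n%:R :> R.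
    have [_ _ fE] := fP; wlog le_ij : i j iL jL ij_n {v1 w1} / (i <= j)%N.
      move=> H; case/orP: (leq_total i j) => le_ij; first exact: H.
      by rewrite distrC; apply: H => //; rewrite word_distC.
    rewrite distrC -natrB // ger0_norm // ler_nat.
    by apply: leq_trans ij_n; rewrite fE ?le_ij.
  have := ler_distD i%:R s t; have := ler_distD j%:R i%:R t.
  by rewrite (distrC t); lra.
case/realizeP: sL => [[i iL ->]|[i iL si]]; first by rewrite realize_nat.
have [Sc [s01 ->]] := realize_edge iL si.
case/realizeP: tL => [[j jL ->]|[j jL tj]]; first by rewrite realize_nat.
have [Se [t01 ->]] := realize_edge jL tj; case=> [] [].
  move=> ji _ ->; have /isometric_path_inj -> := ji => //; try exact: ltnW.
  by rewrite opprB addrA subrK.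
(* The second edge would be the first one reversed, so [f] would return to [f i] after two steps. *)
move=> _ + e _; rewrite mulVKg => ji; exfalso.
have jE : j = i.+1 by apply: isometric_path_inj => //; apply: ltnW.
have : f j.+1 = f i by rewrite -[f j.+1](mulVKg (f j)) e ji invgM invgK mulVKg.
by move=> /isometric_path_inj; lia.
Qed.

Lemma realize_attained (s t : R) : 0 <= s <= (d x y)%:R -> 0 <= t <= (d x y)%:R ->
  path_lengths (realize s) (realize t) `|s - t|.
Proof.
wlog le_st : s t / s <= t.
  move=> H sL tL; case/orP: (le_total s t) => le_st; first exact: H.
  by rewrite distrC; apply: path_lengthsC; apply: H.
move=> sL tL; rewrite distrC ger0_norm ?subr_ge0 //.
have [i [iL si se]] := realize_right_end sL.
have [j [jL tj te]] := realize_left_end tL.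
(* Here [s] is rounded up to [i] and [t] down to [j]. If they cross, both points lie inside the same
   edge and the direct length is used. *)
have [ij|ji] := leqP i j.
  right; exists (f i, i%:R - s), (f j, t - j%:R), (j - i)%N; split=> //=.
    have [_ _ fE] := fP; have := word_dist_walk gen (f i) (f j).
    by rewrite fE ?ij.
  by rewrite natrB //; lra.
have jiR : j.+1%:R <= i%:R :> R by rewrite ler_nat.
have jL' : (j < d x y)%N by exact: leq_trans iL.
have js : j%:R < s < j.+1%:R by move: jiR; rewrite -natr1 in tj *; lra.
have jt : j%:R < t < j.+1%:R by lra.
have [Sc [s01 ->]] := realize_edge jL' js; have [Se [t01 ->]] := realize_edge jL' jt.
left; left; split=> //; rewrite -[LHS]ger0_norm ?subr_ge0 // distrC.
by congr `|_|; lra.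
Qed.

Lemma realize_geodesic :
  geodesic (@cayley_dist R G S) realize (d x y)%:R (Vertex R S x) (Vertex R S y).
Proof.
have [f0 fL _] := fP; split=> // [||s t sL tL].
- by rewrite (realize_nat 0) f0 cayley_dist_xx.
- by rewrite realize_nat fL cayley_dist_xx.
- by apply: cayley_dist_min => [|u]; [apply: realize_attained | apply: realize_le].
Qed.

End Geodesic.

(** Discrete geodesics are realized as sides of a triangle. The nearby point on another side is
    replaced by an end of its cell, a vertex of that discrete geodesic, with the loss of 1 from
    [cayley_dist_vertex]. *)
Lemma hyperbolic_discrete_slim : hyperbolic (@cayley_dist R G S) ->
  exists delta, discrete_slim d delta.
Proof.
case=> delta _ slim; exists (Num.truncn (delta + 1)) => x y z f fP i iL.
have [g gP] := word_geodesic gen y z; have [h hP] := word_geodesic gen z x.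
have geo u v k (kP : isometric_path d k u v) :=
  realize_geodesic kP.
have between u v k w t : isometric_path d k u v -> 0 <= t <= (d u v)%:R ->
    cell_ends (realize k t) w -> (d u w.1 + d w.1 v = d u v)%N.
  move=> kP tL kw; have [j [jL -> _]] := realize_ends kP tL kw.
  have [k0 kL kE] := kP; have := kE 0%N j; have := kE j (d u v).
  rewrite k0 kL; lia.
have near u v k t : isometric_path d k u v -> 0 <= t <= (d u v)%:R ->
    cayley_dist (realize f i%:R) (realize k t) <= delta ->
    exists2 q, (d (f i) q <= Num.truncn (delta + 1))%N & (d u q + d q v = d u v)%N.
  move=> kP tL; rewrite realize_nat => /cayley_dist_vertex[w kw le_w].
  exists w.1; last exact: between kw.
  rewrite truncn_ge_nat //; exact: le_trans le_w.
have iLR : 0 <= (i%:R : R) <= (d x y)%:R by rewrite ler0n ler_nat.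
case: (slim _ _ _ _ _ _ _ _ _ (geo _ _ _ fP) (geo _ _ _ gP) (geo _ _ _ hP) _ iLR).
  by case=> t tL ft; have [q ? ?] := near _ _ _ _ gP tL ft; exists q => //; left.
by case=> t tL ft; have [q ? ?] := near _ _ _ _ hP tL ft; exists q => //; right.
Qed.

Lemma quasiconvex_discrete H : quasiconvex R S H ->
  exists C, forall p q t, H p -> H q -> (t <= d p q)%N ->
    exists r h, [/\ H h, d p r = t, d r q = (d p q - t)%N & (d r h <= C)%N].
Proof.
case=> C C0 qc; exists (Num.truncn (C + 1)) => p q t Hp Hq tL.
have [f fP] := word_geodesic gen p q; have [f0 fL fE] := fP.
have tLR : 0 <= (t%:R : R) <= (d p q)%:R by rewrite ler0n ler_nat.
have [h Hh] := qc p q _ _ Hp Hq (realize_geodesic fP) _ tLR.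
rewrite realize_nat => /cayley_dist_vertex[w /= -> /= le_h].
exists (f t), h; split=> //.
- by rewrite -{1}f0 fE ?subn0.
- by rewrite -{1}fL fE ?tL ?leqnn.
- by rewrite truncn_ge_nat //; lra.
Qed.

End Realization.

(** * Bounded coset representatives and the conclusion *)

(** Applied to the coset map of [K]: finitely many cosets have representatives of bounded length. *)
Lemma finite_image_bounded_lifts (T T' : choiceType) (f : T -> T')
    (len : T -> nat) (A : set T) : finite_set [set f x | x in A] ->
  exists n, forall x, A x -> exists y, [/\ A y, f y = f x & (len y <= n)%N].
Proof.
move=> /finite_seqP[s sE].
have fs x : A x -> f x \in s.
  by move=> Ax; have : [set f x | x in A] (f x) by [exists x]; rewrite sE.
have [n nP] : exists n, forall x, A x -> f x \in s ->
    exists y, [/\ A y, f y = f x & (len y <= n)%N].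
  elim: s {sE fs} => [|v s [n nP]]; first by exists 0%N.
  have [[y [Ay fy]]|none] := pselect (exists y, A y /\ f y = v).
    exists (n + len y)%N => x Ax; rewrite inE => /orP[/eqP fx|xs].
      by exists y; rewrite fy fx leq_addl.
    have [z [Az fz zn]] := nP x Ax xs; exists z; split=> //.
    exact: leq_trans zn (leq_addr _ _).
  exists n => x Ax; rewrite inE => /orP[/eqP fx|xs]; last exact: nP.
  by case: none; exists x.
by exists n => x Ax; apply: nP => //; apply: fs.
Qed.

Lemma normal_closure_normal (G : groupType) (K : set G) :
  normal_subgroup (normal_closure K).
Proof.
split; first split.
- by move=> A [[[A1 _ _] _] _].
- by move=> x y Kx Ky A CA; have [[[_ AM _] _] _] := CA;
  exact: AM (Kx _ CA) (Ky _ CA).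
- by move=> x Kx A CA; have [[[_ _ AV] _] _] := CA; exact: AV (Kx _ CA).
- by move=> g x Kx A CA; have [[_ An] _] := CA; exact: An (Kx _ CA).
Qed.

Theorem proposition5p7 (R : realType) (G : groupType) (Sigma H : set G) :
  finite_symmetric_generating_set Sigma ->
  hyperbolic (@cayley_dist R G Sigma) ->
  subgroup H ->
  quasiconvex R Sigma H ->
  infinite_index [set: G] H ->
  (forall K : set G, subgroup K -> K `<=` H ->
     infinite_set K -> infinite_index (normal_closure K) K)
  /\ (forall N : set G, normal_subgroup N -> N `<=` H -> finite_set N).
Proof.
move=> gen hyp Hgp qc Hinf.
have closure_index (K : set G) : subgroup K -> K `<=` H ->
    infinite_set K -> infinite_index (normal_closure K) K.
  move=> [K1 KM KV] KH Kinf fin; pose N := normal_closure K.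
  have Nn : normal_subgroup N := normal_closure_normal K.
  have KN : K `<=` N by exact: sub_gen_smallest.
  have [delta slim] := hyperbolic_discrete_slim gen hyp.
  have [C qcC] := quasiconvex_discrete gen qc.
  pose d := word_dist Sigma.
  have dxx := word_distxx gen; have dC := word_distC gen.
  have dT := word_dist_triangle gen; have dM := word_dist_mull gen.
  have geo := word_geodesic gen.
  have [E EP] := finite_image_bounded_lifts (d 1%g) fin.
  (* The representative is taken for the coset of the inverse of [n]: if that inverse is [r k], then
     [n = k^-1 r^-1], and left invariance puts [n] at distance [d 1 r] from [k^-1]. *)
  have NE n : N n -> exists2 h, H h & (d n h <= E)%N.
    have [[N1 NM NV] _] := Nn.
    move=> Nn1; have [r [Nr rn rE]] := EP _ (NV _ Nn1).
    have : left_coset n^-1%g K n^-1%g by exists 1%g; rewrite ?mulg1.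
    rewrite -rn => -[k Kk rk].
    exists k^-1%g; first by apply/KH/KV.
    rewrite -[n]invgK -rk invgM /d dC (dMr dM) (dV1 dC dM).
    exact: rE.
  have between x y t : (t <= d x y)%N -> exists p, d x p = t /\ d p y = (d x y - t)%N.
    move=> tL; have [f [f0 fL fE]] := geo x y.
    by exists (f t); rewrite /d -{1}f0 -{1}fL !fE ?subn0 // ?tL /=.
  have d4 := slim_four_point dxx dC dT geo slim.
  have [B near] := near_quasiconvex_overgroup dxx dC dT dM
    (word_ball_finite gen) between d4 Nn (sub_infinite_set KN Kinf) NE qcC.
  exact: (near_finite_index dM (word_ball_finite gen) Hgp near Hinf).
split=> // N Nn NH; have [Ngp _] := Nn; have [N1 NM NV] := Ngp.
apply: contrapT => Ninf; apply: (closure_index N Ngp NH Ninf).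
(* A normal [N] is its own normal closure, and [N] is the only coset of [N] in itself. *)
rewrite /normal_closure smallest_id //.
apply: (sub_finite_set _ (finite_set1 N)) => _ [g Ng <-] /=.
apply/seteqP; split=> [_ [k Nk <-]|k Nk]; first exact: NM.
by exists (g^-1 * k)%g; [apply: NM => //; apply: NV|rewrite mulVKg].
Qed.
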